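(* Let $X$ be a path-connected $G_1$-space and $Y$ a path-connected $G_2$-space. If $X\times Y$ is $(G_1\times G_2)$-completely normal, then $$\mathrm{cat}_{G_1\times G_2}^{\#}(X\times Y)\le \mathrm{cat}_{G_1}^{\#}(X)+\mathrm{cat}_{G_2}^{\#}(Y)-1,$$ where $G_1\times G_2$ acts on $X\times Y$ componentwise.
   Context: For a $G$-space $X$, $\mathrm{cat}_G^{\#}(X)$ is the smallest $n$ such that $X$ has an open cover by $n$ $G$-invariant sets each of whose inclusions into $X$ is null-homotopic (non-equivariantly); it is $\infty$ if no such $n$ exists. A $G$-space $X$ is $G$-completely normal if for any two $G$-invariant subsets $A,B\subseteq X$ with $\overline A\cap B=A\cap\overline B=\emptyset$ there exist disjoint $G$-invariant open subsets $U\supseteq A$ and $V\supseteq B$. *)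

(* Defs.v *)
From HB Require Import structures.
From mathcomp Require Import all_boot all_order all_algebra.
From mathcomp Require Import all_classical all_reals all_analysis.
Import Order.TTheory GRing.Theory Num.Theory.
Import numFieldNormedType.Exports.

Set Implicit Arguments.
Unset Strict Implicit.
Unset Printing Implicit Defensive.

Local Open Scope classical_set_scope.
Local Open Scope ring_scope.

HB.structure Definition PreTopologicalGroup := {G of Topological G & Group G}.

HB.mixin Record PreTopologicalGroup_isTopologicalGroup G
    & PreTopologicalGroup G := {
  mulg_continuous : continuous (fun p : G * G => (p.1 * p.2)%g) ;
  invg_continuous : continuous (fun x : G => (x^-1)%g) ;
}.

#[short(type="topologicalGroupType")]
HB.structure Definition TopologicalGroup :=
  {G of PreTopologicalGroup G & PreTopologicalGroup_isTopologicalGroup G}.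

Section ProdTopologicalGroup.
Context {G1 G2 : topologicalGroupType}.

Let prod_mulg_continuous :
  continuous (fun p : (G1 * G2) * (G1 * G2) => (p.1 * p.2)%g).
Proof.
move=> p; apply: cvg_pair => /=.
- apply: (@continuous_comp _ _ _
    (fun q : (G1 * G2) * (G1 * G2) => (q.1.1, q.2.1))
    (fun q : G1 * G1 => (q.1 * q.2)%g)); last exact: mulg_continuous.
  by apply: cvg_pair; apply: continuous_comp; do ?exact: cvg_fst;
    exact: cvg_snd.
- apply: (@continuous_comp _ _ _
    (fun q : (G1 * G2) * (G1 * G2) => (q.1.2, q.2.2))
    (fun q : G2 * G2 => (q.1 * q.2)%g)); last exact: mulg_continuous.
  by apply: cvg_pair; apply: continuous_comp; do ?exact: cvg_fst;
    exact: cvg_snd.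
Qed.

Let prod_invg_continuous : continuous (fun x : G1 * G2 => (x^-1)%g).
Proof.
move=> p; apply: cvg_pair => /=; apply: continuous_comp;
  do ?[exact: cvg_fst | exact: cvg_snd]; exact: invg_continuous.
Qed.

HB.instance Definition _ := PreTopologicalGroup_isTopologicalGroup.Build
  (G1 * G2)%type prod_mulg_continuous prod_invg_continuous.

End ProdTopologicalGroup.

HB.mixin Record isGSpace (G : topologicalGroupType) X & Topological X := {
  gact : G -> X -> X ;
  gact1 : forall x, gact 1%g x = x ;
  gactM : forall g h x, gact (g * h)%g x = gact g (gact h x) ;
  gact_continuous : continuous (fun p : G * X => gact p.1 p.2) ;
}.

#[short(type="gSpaceType")]
HB.structure Definition GSpace (G : topologicalGroupType) :=
  {X of Topological X & isGSpace G X}.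

Section ProdGSpace.
Context {G1 G2 : topologicalGroupType} {X : gSpaceType G1} {Y : gSpaceType G2}.

Let prod_gact (g : G1 * G2) (p : X * Y) : X * Y :=
  (gact g.1 p.1, gact g.2 p.2).

Let prod_gact1 p : prod_gact 1%g p = p.
Proof. by case: p => x y; rewrite /prod_gact /= !gact1. Qed.

Let prod_gactM g h p : prod_gact (g * h)%g p = prod_gact g (prod_gact h p).
Proof. by rewrite /prod_gact /= !gactM. Qed.

Let prod_gact_continuous :
  continuous (fun p : (G1 * G2) * (X * Y) => prod_gact p.1 p.2).
Proof.
move=> p; apply: cvg_pair => /=.
- apply: (@continuous_comp _ _ _
    (fun q : (G1 * G2) * (X * Y) => (q.1.1, q.2.1))
    (fun q : G1 * X => gact q.1 q.2)); last exact: gact_continuous.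
  by apply: cvg_pair; apply: continuous_comp; do ?exact: cvg_fst;
    exact: cvg_snd.
- apply: (@continuous_comp _ _ _
    (fun q : (G1 * G2) * (X * Y) => (q.1.2, q.2.2))
    (fun q : G2 * Y => gact q.1 q.2)); last exact: gact_continuous.
  by apply: cvg_pair; apply: continuous_comp; do ?exact: cvg_fst;
    exact: cvg_snd.
Qed.

HB.instance Definition _ := isGSpace.Build (G1 * G2)%type (X * Y)%type
  prod_gact1 prod_gactM prod_gact_continuous.

End ProdGSpace.

(* As usual, path-connected spaces are nonempty. *)
Definition path_connected (R : realType) (X : topologicalType) : Prop :=
  [set: X] !=set0 /\
  forall x y : X, exists f : R -> X,
    [/\ {within `[0, 1], continuous f}, f 0 = x & f 1 = y].

(* The restrictions of f and g to U are homotopic; only the values of the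
   homotopy H on U x [0, 1] matter. *)
Definition homotopic_on (R : realType) (X Y : topologicalType) (U : set X)
    (f g : X -> Y) : Prop :=
  exists H : X * R -> Y,
    [/\ {within U `*` `[0, 1], continuous H},
        forall x, U x -> H (x, 0) = f x &
        forall x, U x -> H (x, 1) = g x].

Definition null_homotopic_on (R : realType) (X Y : topologicalType) (U : set X)
    (f : X -> Y) : Prop :=
  exists c : Y, homotopic_on R U f (cst c).

Definition ginvariant (G : topologicalGroupType) (X : gSpaceType G)
    (A : set X) : Prop :=
  forall (g : G) (x : X), A x -> A (gact g x).

Definition gcompletely_normal (G : topologicalGroupType) (X : gSpaceType G) :
    Prop :=
  forall A B : set X, ginvariant A -> ginvariant B ->
    separated A B ->
    exists U V : set X,
      [/\ open U /\ ginvariant U, open V /\ ginvariant V,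
          A `<=` U, B `<=` V & U `&` V = set0].

(* The inclusion of U into X is the restriction of the identity to U. *)
Definition cat_cover (R : realType) (G : topologicalGroupType)
    (X : gSpaceType G) (n : nat) : Prop :=
  exists U : 'I_n -> set X,
    (forall i, [/\ open (U i), ginvariant (U i) &
                   null_homotopic_on R (U i) (@id X)]) /\
    \bigcup_i U i = [set: X].

Definition cat_sharp (R : realType) (G : topologicalGroupType)
    (X : gSpaceType G) : \bar R :=
  match pselect (exists n, `[< cat_cover R X n >]) with
  | left ex_n => (ex_minn ex_n)%:R%:E
  | right _ => +oo%E
  end.

Arguments gcompletely_normal : clear implicits.
Arguments cat_sharp : clear implicits.

(* Main.v *)
Require Import Defs.
From HB Require Import structures.
From mathcomp Require Import all_boot all_order all_algebra.
From mathcomp Require Import all_classical all_reals all_analysis.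
From mathcomp Require Import lra zify.
Import Order.TTheory GRing.Theory Num.Theory.
Import numFieldNormedType.Exports.
Set Implicit Arguments.
Unset Strict Implicit.
Unset Printing Implicit Defensive.
Local Open Scope classical_set_scope.
Local Open Scope ring_scope.

(** The inequality is the invariant form of the product inequality for
Lusternik-Schnirelmann category, and the argument counts strata.

Suppose that X is covered by n invariant open sets that are null-homotopic in
X, and let r x be the least index of a member containing x.  Then r takes
values below n, is constant on orbits, and is upper semicontinuous in the
sense that every [r <= i] is open (it is a union of members of the cover);
moreover [r = i] lies in the i-th member.  Such a function is called a rank
here ([cat_rank], [cat_cover_rank]).  With a rank s for a cover of Y by m sets,
r x + s y takes at most n + m - 1 values on X x Y, so it suffices to put
each level set [r + s = k] inside one invariant, open, null-homotopic set.

The level set is the union of the pieces S_i = [r = i, s = k - i].  For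
i < j, S_i lies in the open set [r <= i], which misses S_j, while S_j lies in
the open set [s <= k - j], which misses S_i; hence the pieces are pairwise
separated ([open_separated]).  Invariant complete normality, applied to each
pair, gives pairwise disjoint invariant open neighbourhoods D_i
([gcompletely_normal_disjoint_nbhs]).  Each D_i is cut down to the product of
the i-th set of X and the (k - i)-th set of Y, which is null-homotopic by the
product homotopy ([contracts_setX]).  Homotopies on disjoint open sets glue,
provided that they end at the same point ([contracts_bigcup_disjoint]); path
connectedness allows the final point to be prescribed ([contracts_path]). *)

(** * Continuity at a point *)

Lemma near_eq_continuous_at (T S : topologicalType) (f g : T -> S) (x : T) :
  (\forall y \near x, g y = f y) -> {for x, continuous f} ->
  {for x, continuous g}.
Proof.
move=> gf cf; rewrite /prop_for /continuous_at (nbhs_singleton gf).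
by apply: cvg_trans cf; apply: near_eq_cvg; near do apply: esym.
Unshelve. all: by end_near.
Qed.

Lemma continuous_at_pair (T S1 S2 : topologicalType) (f : T -> S1)
    (g : T -> S2) (x : T) :
  {for x, continuous f} -> {for x, continuous g} ->
  {for x, continuous (fun y => (f y, g y))}.
Proof. by move=> cf cg; exact: cvg_pair. Qed.

(** This turns continuity relative to A into genuine continuity, once h is
precomposed with a map that stays in A near x. *)
Lemma within_continuous_comp (T S V : topologicalType) (A : set S)
    (f : T -> S) (h : S -> V) (x : T) :
  (\forall y \near x, A (f y)) -> {for x, continuous f} ->
  {within A, continuous h} -> {for x, continuous (h \o f)}.
Proof.
move=> Af cf /subspace_continuousP ch.
apply: (cvg_comp _ _ _ (ch _ (nbhs_singleton Af))).
move=> B wB.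
have cB : \forall y \near x, A (f y) -> B (f y) by exact: (cf _ wB).
suff : \forall y \near x, B (f y) by [].
by apply: filterS2 Af cB => y Ay; apply.
Qed.

(** * Clamping the time parameter to the unit interval *)

Section UnitClamp.
Context {R : realType}.

Definition unit_clamp (t : R) : R := Num.max 0 (Num.min t 1).

Lemma unit_clamp_itv t : `[0, 1]%classic (unit_clamp t).
Proof.
by rewrite /= in_itv /= /unit_clamp le_max lexx /= ge_max ler01 ge_min lexx orbT.
Qed.

Lemma unit_clamp_le0 t : t <= 0 -> unit_clamp t = 0.
Proof. by move=> t0; rewrite /unit_clamp max_l // ge_min t0. Qed.

Lemma unit_clamp_ge1 t : 1 <= t -> unit_clamp t = 1.
Proof. by move=> t1; rewrite /unit_clamp min_r // max_r. Qed.

Lemma unit_clamp_continuous : continuous unit_clamp.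
Proof.
move=> t; apply: (@continuous_max R R (cst 0) (fun t => Num.min t 1)).
  exact: cvg_cst.
by apply: (@continuous_min R R id (cst 1)); [exact: cvg_id|exact: cvg_cst].
Qed.

End UnitClamp.

(** * Contractions of open sets inside a space *)

Section ContractsTo.
Context {R : realType}.

(** For open U this is null-homotopy of the inclusion with prescribed final
point x0.  The homotopy has all of R as time axis and is stationary outside
the unit interval: it is then continuous at the points over U in the full
product, and homotopies can be concatenated by overlapping their stationary
phases, with no pasting along closed sets. *)
Definition contracts_to (X : topologicalType) (U : set X) (x0 : X) : Prop :=
  exists H : X * R -> X,
    [/\ forall p, U p.1 -> {for p, continuous H},
        forall x t, U x -> t <= 0 -> H (x, t) = x &
        forall x t, U x -> 1 <= t -> H (x, t) = x0].

Lemma near_fst (X : topologicalType) (U : set X) (p : X * R) :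
  open U -> U p.1 -> \forall q \near p, U q.1.
Proof. by move=> oU Up; apply: cvg_fst; exact: open_nbhs_nbhs. Qed.

Lemma near_snd (X : topologicalType) (V : set R) (p : X * R) :
  open V -> V p.2 -> \forall q \near p, V q.2.
Proof. by move=> oV Vp; apply: cvg_snd; exact: open_nbhs_nbhs. Qed.

Lemma null_homotopic_contracts (X : topologicalType) (U : set X) :
  open U -> null_homotopic_on R U (@id X) -> exists c, contracts_to U c.
Proof.
move=> oU [c [H [cH H0 H1]]]; exists c.
exists (H \o (fun p => (p.1, unit_clamp p.2))); split.
- move=> p Up; apply: within_continuous_comp cH.
    by near=> q; split; [near: q; exact: near_fst|exact: unit_clamp_itv].
  apply: continuous_at_pair; first exact: cvg_fst.
  by apply: continuous_comp; [exact: cvg_snd|exact: unit_clamp_continuous].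
- by move=> x t Ux t0 /=; rewrite unit_clamp_le0 // H0.
- by move=> x t Ux t1 /=; rewrite unit_clamp_ge1 // H1.
Unshelve. all: by end_near. Qed.

Lemma contracts_null_homotopic (X : topologicalType) (U : set X) (x0 : X) :
  contracts_to U x0 -> null_homotopic_on R U (@id X).
Proof.
move=> [H [cH H0 H1]]; exists x0, H; split.
- apply/subspace_continuousP => p [Up _].
  by apply: cvg_trans (cH p Up); apply: cvg_app; exact: cvg_within.
- by move=> x Ux; exact: H0.
- by move=> x Ux; exact: H1.
Qed.

(** The final point c of the contraction is moved to x0 along a path.  The path,
started at time 2, is switched on at time 3/2: for times between 1 and 2 both
formulas give c, so near every point one of the two continuous formulas is
valid.  The total duration 3 is then rescaled to 1. *)
Lemma contracts_path (X : topologicalType) (U : set X) (c x0 : X) :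
  open U -> path_connected R X -> contracts_to U c -> contracts_to U x0.
Proof.
move=> oU [_ /(_ c x0)[f [cf f0 f1]]] [H [cH H0 H1]].
pose L (p : X * R) :=
  if p.2 < 3 / 2 then H p else f (unit_clamp (p.2 - 2)).
have cL p : U p.1 -> {for p, continuous L}.
  move=> Up; have [p32|p32] := ltP p.2 (3 / 2).
    apply: near_eq_continuous_at (cH p Up); near=> q; rewrite /L ifT //.
    by near: q; exact: (near_snd (@open_lt R (3 / 2))).
  have p1 : 1 < p.2 by lra.
  apply: (@near_eq_continuous_at _ _
    (f \o (fun q : X * R => unit_clamp (q.2 - 2)))); last first.
    apply: within_continuous_comp cf.
      by near=> q; exact: unit_clamp_itv.
    apply: continuous_comp; last exact: unit_clamp_continuous.
    by apply: cvgB; [exact: cvg_snd|exact: cvg_cst].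
  near=> q; rewrite /L; case: ltP => //= q32.
  have Uq : U q.1 by near: q; exact: near_fst.
  have q1 : 1 < q.2.
    by near: q; exact: (near_snd (@open_gt R 1)).
  rewrite (surjective_pairing q) H1 ?(ltW q1) //= unit_clamp_le0 ?f0 //; lra.
(* Time 3 is when the path, which starts at time 2, reaches x0. *)
exists (L \o (fun p => (p.1, 3 * p.2))); split.
- move=> p Up; apply: continuous_comp; last exact: cL.
  apply: continuous_at_pair; first exact: cvg_fst.
  by apply: cvgM; [exact: cvg_cst|exact: cvg_snd].
- by move=> x t Ux t0; rewrite /L /= ifT; [rewrite H0 //; lra|lra].
- move=> x t Ux t1; rewrite /L /= ifF; last by apply/negbTE; rewrite -leNgt; lra.
  by rewrite unit_clamp_ge1 //; lra.
Unshelve. all: by end_near. Qed.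

Lemma contracts_sub (X : topologicalType) (U V : set X) (x0 : X) :
  U `<=` V -> contracts_to V x0 -> contracts_to U x0.
Proof.
move=> UV [H [cH H0 H1]]; exists H; split=> [p|x t|x t] /UV Vx.
- exact: cH.
- exact: H0.
- exact: H1.
Qed.

Lemma contracts_setX (X Y : topologicalType) (U : set X) (V : set Y) x0 y0 :
  contracts_to U x0 -> contracts_to V y0 -> contracts_to (U `*` V) (x0, y0).
Proof.
move=> [H [cH H0 H1]] [K [cK K0 K1]].
exists (fun p => (H (p.1.1, p.2), K (p.1.2, p.2))); split.
- move=> p [Up Vp]; apply: continuous_at_pair.
  + apply: (@continuous_comp _ _ _ (fun p : X * Y * R => (p.1.1, p.2)) H);
      last exact: cH.
    apply: continuous_at_pair; last exact: cvg_snd.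
    by apply: continuous_comp; exact: cvg_fst.
  + apply: (@continuous_comp _ _ _ (fun p : X * Y * R => (p.1.2, p.2)) K);
      last exact: cK.
    apply: continuous_at_pair; last exact: cvg_snd.
    by apply: continuous_comp; [exact: cvg_fst|exact: cvg_snd].
- by move=> [x y] t [Ux Vy] t0 /=; rewrite H0 // K0.
- by move=> [x y] t [Ux Vy] t1 /=; rewrite H1 // K1.
Qed.

(** Over W_i the glued homotopy is the i-th one; since the W_i are open and
disjoint, this choice of i is locally constant.  The common final point is what
makes the end of the glued homotopy constant on the whole union. *)
Lemma contracts_bigcup_disjoint (I : Type) (X : topologicalType)
    (W : I -> set X) (x0 : X) :
  (forall i, open (W i)) -> trivIset setT W ->
  (forall i, contracts_to (W i) x0) -> contracts_to (\bigcup_i W i) x0.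
Proof.
move=> oW tW /choice[H HP].
have /choice[k kP] (x : X) : exists o : option I,
    forall i, W i x -> o = Some i.
  have [[i Wi]|nW] := pselect (exists i, W i x).
    by exists (Some i) => j Wj; congr Some; apply: tW => //; exists x.
  by exists None => i Wi; case: nW; exists i.
exists (fun p => if k p.1 is Some i then H i p else x0); split.
- move=> p [i _ Wp]; have [cH _ _] := HP i.
  apply: near_eq_continuous_at (cH p Wp); near=> q.
  by rewrite (kP q.1 i) //; near: q; exact: near_fst.
- by move=> x t [i _ Wx] t0 /=; rewrite (kP x i) //; have [_ + _] := HP i; apply.
- by move=> x t [i _ Wx] t1 /=; rewrite (kP x i) //; have [_ _ +] := HP i; apply.
Unshelve. all: by end_near. Qed.

End ContractsTo.

(** * Separated invariant sets *)

(** From two sets to finitely many: D_i intersects, over all j, the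
neighbourhood of S_i obtained by separating the pair (i, j) with the one
obtained by separating (j, i).  Keeping both orders makes the definition symmetric: for
distinct i and j, D_i and D_j lie in the two disjoint sets chosen for
(i, j). *)
Lemma gcompletely_normal_disjoint_nbhs (G : topologicalGroupType)
    (Z : gSpaceType G) (I : finType) (S : I -> set Z) :
  gcompletely_normal G Z -> (forall i, ginvariant (S i)) ->
  (forall i j, i != j -> separated (S i) (S j)) ->
  exists D : I -> set Z,
    [/\ forall i, open (D i), forall i, ginvariant (D i),
        forall i, S i `<=` D i & trivIset setT D].
Proof.
move=> nZ iS sS.
have /choice[U UP] (ij : I * I) : exists UV : set Z * set Z, ij.1 != ij.2 ->
    [/\ open UV.1 /\ ginvariant UV.1, open UV.2 /\ ginvariant UV.2,
        S ij.1 `<=` UV.1, S ij.2 `<=` UV.2 & UV.1 `&` UV.2 = set0].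
  have [_|neij] := boolP (ij.1 == ij.2).
    by exists (set0, set0).
  by have [U [V UVP]] := nZ _ _ (iS _) (iS _) (sS _ _ neij); exists (U, V).
pose D i := [set z | forall j, i != j -> (U (i, j)).1 z /\ (U (j, i)).2 z].
exists D; split.
- move=> i; rewrite openE => z Dz; apply: filter_forall => j.
  have [->|ij] := eqVneq i j; first exact: filterE.
  have [[oU _] _ _ _ _] := UP (i, j) ij.
  have ji : j != i by rewrite eq_sym.
  have [_ [oV _] _ _ _] := UP (j, i) ji.
  have [Uz Vz] := Dz j ij.
  by near=> w => _; split; near: w; exact: open_nbhs_nbhs.
- move=> i g z Dz j ij; have [Uz Vz] := Dz j ij.
  have [[_ iU] _ _ _ _] := UP (i, j) ij.
  have ji : j != i by rewrite eq_sym.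
  have [_ [_ iV] _ _ _] := UP (j, i) ji.
  by split; [exact: iU|exact: iV].
- move=> i z Sz j ij; have [_ _ SU _ _] := UP (i, j) ij.
  have ji : j != i by rewrite eq_sym.
  have [_ _ _ SV _] := UP (j, i) ji.
  by split; [exact: SU|exact: SV].
- move=> i j _ _ [z [Di Dj]]; apply/eqP/negPn/negP => ij.
  have ji : j != i by rewrite eq_sym.
  have [_ _ _ _ UV0] := UP (i, j) ij.
  have [Uz _] := Di j ij; have [_ Vz] := Dj i ji.
  by have : set0 z by rewrite -UV0.
Unshelve. all: by end_near. Qed.

Lemma open_separated (Z : topologicalType) (A B O P : set Z) :
  open O -> open P -> A `<=` O -> B `<=` P -> O `&` B = set0 ->
  A `&` P = set0 -> separated A B.
Proof.
have sep (C D Q : set Z) : open Q -> C `<=` Q -> Q `&` D = set0 ->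
    C `&` closure D = set0.
  move=> oQ CQ QD; apply/seteqP; split => // z [Cz cDz].
  have [w [Dw Qw]] := cDz Q (open_nbhs_nbhs (conj oQ (CQ _ Cz))).
  by have : set0 w by rewrite -QD.
move=> oO oP AO BP OB AP; split; last exact: sep OB.
by rewrite setIC; apply: sep oP BP _; rewrite setIC.
Qed.

Lemma ginvariant_gactP (G : topologicalGroupType) (X : gSpaceType G) (A : set X)
    (g : G) (x : X) :
  ginvariant A -> A (gact g x) <-> A x.
Proof.
move=> iA; split; last exact: iA.
by move=> /(iA g^-1%g); rewrite -gactM mulVg gact1.
Qed.

(** * Ranks and covers *)

Section Rank.
Context {R : realType}.

(** The stratified form of a cover by n invariant null-homotopic open sets, the
strata being the fibres of r.  Ranks on two factors can be added, which is
where the bound n + m - 1 comes from.  The open sets all contract to the same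
point x0, so that contractions of disjoint sets can be glued. *)
Definition cat_rank (G : topologicalGroupType) (X : gSpaceType G) (x0 : X)
    (n : nat) (r : X -> nat) : Prop :=
  [/\ forall x, (r x < n)%N,
      forall g x, r (gact g x) = r x,
      forall i, open [set x | (r x <= i)%N] &
      forall i, exists U : set X,
        [/\ open U, ginvariant U, r @^-1` [set i] `<=` U &
            contracts_to (R := R) U x0]].

(** The rank of x is the least index of a member of the cover containing x. *)
Lemma cat_cover_rank (G : topologicalGroupType) (X : gSpaceType G) (x0 : X)
    (n : nat) :
  path_connected R X -> cat_cover R X n -> exists r, @cat_rank G X x0 n r.
Proof.
move=> pX [U [UP Ucov]].
(* The cover indexed by all naturals, empty beyond n. *)
pose V (i : nat) := [set x | exists2 j : 'I_n, val j = i & U j x].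
have oV i : open (V i).
  rewrite openE => x [j ji Ujx]; have [oU _ _] := UP j.
  by near=> y; exists j => //; near: y; exact: open_nbhs_nbhs.
have Vcov x : exists i, `[< V i x >].
  have : setT x by [].
  rewrite -Ucov => -[j _ Ujx].
  by exists (val j); apply/asboolP; exists j.
have VV g x i : `[< V i (gact g x) >] = `[< V i x >].
  by apply: asbool_equiv_eq; split => -[j ji Ujx]; exists j => //;
    have [_ iU _] := UP j; apply/(ginvariant_gactP g x iU).
exists (fun x => ex_minn (Vcov x)); split.
- by move=> x; case: ex_minnP => m /asboolP[j <- _] _ /=.
- by move=> g x; apply: eq_ex_minn => i; exact: VV.
- move=> i; rewrite openE => x /=; case: ex_minnP => m /asboolP Vmx _ mi.
  near=> y => /=; case: ex_minnP => k _ kmin.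
  apply: leq_trans mi; apply: kmin; apply/asboolP.
  by near: y; exact: open_nbhs_nbhs.
- move=> i; have [ni|ni] := ltP i n; last first.
    exists set0; split => //; first exact: open0.
      move=> x /=; case: ex_minnP => m /asboolP[j <- _] _ /= ji.
      by have := ltn_ord j; rewrite ji ltnNge => /negP[].
    by exists fst; split.
  have [oU iU /(null_homotopic_contracts oU)[c Uc]] := UP (Ordinal ni).
  exists (U (Ordinal ni)); split => //; last exact: contracts_path Uc.
  move=> x /=; case: ex_minnP => m /asboolP[j jm Ujx] _ mi.
  by rewrite (_ : Ordinal ni = j) //; apply: val_inj; rewrite /= jm mi.
Unshelve. all: by end_near. Qed.

(** One member of the product cover for each value of the sum of the two ranks,
which is at most (n - 1) + (m - 1). *)
Lemma cat_cover_prod (G1 G2 : topologicalGroupType) (X : gSpaceType G1)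
    (Y : gSpaceType G2) (n m : nat) :
  path_connected R X -> path_connected R Y ->
  gcompletely_normal (G1 * G2)%type (X * Y)%type ->
  cat_cover R X n -> cat_cover R Y m ->
  cat_cover R (X * Y)%type (n + m).-1.
Proof.
move=> pX pY nXY cX cY.
have [[x0 _] _] := pX; have [[y0 _] _] := pY.
have [r [rn ri ro rU]] := cat_cover_rank x0 pX cX.
have [s [sm si so sV]] := cat_cover_rank y0 pY cY.
pose S k (i : 'I_k.+1) : set (X * Y) :=
  [set p | r p.1 = i /\ s p.2 = (k - i)%N].
have /choice[W WP] (k : nat) : exists W : set (X * Y),
    [/\ open W, ginvariant W, null_homotopic_on R W id &
        forall p, (r p.1 + s p.2)%N = k -> W p].
  have iS i : ginvariant (@S k i).
    by move=> g p [rp sp]; split; rewrite ?ri ?si.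
  have sS_lt (i j : 'I_k.+1) : (i < j)%N -> separated (@S k i) (@S k j).
    move=> ij; have := ltn_ord j => jk.
    apply: (@open_separated _ _ _ [set p | (r p.1 <= i)%N]
      [set p | (s p.2 <= k - j)%N]).
    - by apply: (open_comp (f := fst)) (ro i) => p _; exact: cvg_fst.
    - by apply: (open_comp (f := snd)) (so (k - j)%N) => p _; exact: cvg_snd.
    - by move=> p [/= -> _].
    - by move=> p [/= _ ->].
    - by apply/seteqP; split => // p [/= + [rp sp]]; rewrite rp leqNgt ij.
    - apply/seteqP; split => // p [[rp sp]] /=; rewrite sp; lia.
  have sS (i j : 'I_k.+1) : i != j -> separated (@S k i) (@S k j).
    move=> ij; have : (i < j)%N || (j < i)%N by rewrite -neq_ltn.
    by case/orP => /sS_lt //; rewrite separatedC.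
  have [D [oD iD SD tD]] := gcompletely_normal_disjoint_nbhs nXY iS sS.
  have /choice[U UP] := rU.
  have /choice[V VP] := sV.
  pose W (i : 'I_k.+1) := D i `&` (U i `*` V (k - i)%N).
  have oW i : open (W i).
    have [oU _ _ _] := UP i; have [oV _ _ _] := VP (k - i)%N.
    apply: openI => //; apply: openI.
      by apply: (open_comp (f := fst)) oU => p _; exact: cvg_fst.
    by apply: (open_comp (f := snd)) oV => p _; exact: cvg_snd.
  exists (\bigcup_i W i); split.
  - by apply: bigcup_open => i _.
  - move=> g p [i _ [Dp [Up Vp]]]; exists i => //.
    have [_ iU _ _] := UP i; have [_ iV _ _] := VP (k - i)%N.
    by split; [exact: iD|split; [exact: iU|exact: iV]].
  - apply: (@contracts_null_homotopic _ _ _ (x0, y0)).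
    apply: contracts_bigcup_disjoint => //.
      by move=> i j _ _ [p [[Di _] [Dj _]]]; apply: tD => //; exists p.
    move=> i; have [_ _ _ cU] := UP i; have [_ _ _ cV] := VP (k - i)%N.
    by apply: contracts_sub (contracts_setX cU cV) => p [].
  - move=> p rsk; have ik : (r p.1 < k.+1)%N by lia.
    have Sp : @S k (Ordinal ik) p by split => //=; lia.
    have [_ _ rUp _] := UP (r p.1); have [_ _ sVp _] := VP (s p.2).
    exists (Ordinal ik) => //; split; first exact: SD.
    have [_ /= <-] := Sp.
    by split; [exact: rUp|exact: sVp].
exists (fun k : 'I_(n + m).-1 => W k); split.
  by move=> k; have [? ? ? _] := WP k.
apply/seteqP; split => // p _.
have kn : (r p.1 + s p.2 < (n + m).-1)%N by have := rn p.1; have := sm p.2; lia.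
by exists (Ordinal kn) => //; have [_ _ _ +] := WP (r p.1 + s p.2)%N; apply.
Qed.

(** * From covers to the category *)

Lemma cat_sharp_le (G : topologicalGroupType) (X : gSpaceType G) (n : nat) :
  cat_cover R X n -> (cat_sharp R G X <= n%:R%:E)%E.
Proof.
move=> cn; rewrite /cat_sharp; case: pselect => [ex_n|[]]; last first.
  by exists n; apply/asboolP.
case: ex_minnP => k _ kmin; rewrite lee_fin ler_nat.
by apply: kmin; apply/asboolP.
Qed.

Lemma cat_sharp_cases (G : topologicalGroupType) (X : gSpaceType G) :
  cat_sharp R G X = +oo%E \/
  exists2 n, cat_cover R X n & cat_sharp R G X = n%:R%:E.
Proof.
rewrite /cat_sharp; case: pselect => [ex_n|]; last by left.
by right; case: ex_minnP => n /asboolP cn _; exists n.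
Qed.

Lemma cat_cover_gt0 (G : topologicalGroupType) (X : gSpaceType G) (n : nat) :
  [set: X] !=set0 -> cat_cover R X n -> (0 < n)%N.
Proof.
move=> [x _] [U [_ Ucov]]; have : setT x by [].
by rewrite -Ucov => -[[i i_n] _ _]; exact: leq_ltn_trans i_n.
Qed.

End Rank.

Theorem proposition3p22 (R : realType) (G1 G2 : topologicalGroupType)
    (X : gSpaceType G1) (Y : gSpaceType G2) :
  path_connected R X -> path_connected R Y ->
  gcompletely_normal (G1 * G2)%type (X * Y)%type ->
  (cat_sharp R (G1 * G2)%type (X * Y)%type
     <= cat_sharp R G1 X + cat_sharp R G2 Y - 1)%E.
Proof.
move=> pX pY nXY.
have [->|[n cn ->]] := cat_sharp_cases (R := R) X.
  have [->|[m _ ->]] := cat_sharp_cases (R := R) Y; exact: leey.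
have [->|[m cm ->]] := cat_sharp_cases (R := R) Y; first exact: leey.
apply: le_trans (cat_sharp_le (cat_cover_prod pX pY nXY cn cm)) _.
(* As n is positive, the truncated predecessor of n + m is n + m - 1. *)
have n0 := cat_cover_gt0 pX.1 cn.
rewrite lee_fin -natrD -[1]/(1%:R) -natrB ?ler_nat; lia.
Qed.
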